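(* For every integer $d \ge 1$ and every real $p > 0$, there exists a positive constant $c_{d,p}$ depending only on $d$ and $p$ such that for every integer $n \ge 2$, $$R_n(\mathcal{F}_{\mathcal{G}_2(p,K)}, h^2) \;\ge\; c_{d,p}\, n^{-\frac{p}{p+d}} (\log n)^{-\frac{3d}{2}} \qquad \text{for all } K \ge c_{d,p}^{-1},$$ where $R_n(\mathcal{F}_{\mathcal{G}_2(p,K)}, h^2)$ is the minimax risk, under squared Hellinger loss and based on $n$ i.i.d. observations, over Gaussian location mixture densities on $\mathbb{R}^d$ whose mixing measure lies in the bounded-moment class $\mathcal{G}_2(p,K)$.
   Context: Let $\phi(x) = (2\pi)^{-1/2} e^{-x^2/2}$ be the standard univariate normal density. For a class $\mathcal{G}$ of (Borel) probability measures on $\mathbb{R}^d$, $\mathcal{F}_{\mathcal{G}}$ denotes the class of all densities on $\mathbb{R}^d$ of the form $$(x_1,\ldots,x_d) \mapsto \int \phi(x_1-u_1)\phi(x_2-u_2)\cdots\phi(x_d-u_d)\, dG(u_1,\ldots,u_d), \qquad G \in \mathcal{G}.$$ For $p > 0$ and $K > 0$, $\mathcal{G}_2(p,K)$ is the class of all probability measures $G$ on $\mathbb{R}^d$ satisfying $$\left(\int \|u\|^p\, dG(u)\right)^{1/p} \le K,$$ where $\|\cdot\|$ is the Euclidean norm. The squared Hellinger loss is $h^2(f,g) := \int_{\mathbb{R}^d} \left(\sqrt{f(x)}-\sqrt{g(x)}\right)^2 dx$. One observes i.i.d. random vectors $X_1,\ldots,X_n$ with unknown density $f^* \in \mathcal{F}_{\mathcal{G}}$.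 The minimax risk is $$R_n(\mathcal{F}_{\mathcal{G}}, h^2) := \inf_{\hat f_n}\ \sup_{f^*\in\mathcal{F}_{\mathcal{G}}} \mathbb{E}_{f^*} h^2(\hat f_n, f^* ),$$ where the infimum is over all estimators $\hat f_n$, i.e. measurable functions of the data $X_1,\ldots,X_n$ taking values in nonnegative functions on $\mathbb{R}^d$, and $\mathbb{E}_{f^*}$ is expectation when $X_1,\ldots,X_n$ are i.i.d. with density $f^*$. *)

(* Defs.v *)
From HB Require Import structures.
From mathcomp Require Import all_boot all_order all_algebra.
From mathcomp Require Import all_classical all_reals all_analysis.

Set Implicit Arguments.
Unset Strict Implicit.
Unset Printing Implicit Defensive.
Import Order.TTheory GRing.Theory Num.Theory.
Import numFieldNormedType.Exports.

Local Open Scope classical_set_scope.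
Local Open Scope ring_scope.

(* R^d with the sigma-algebra generated by the coordinate maps, i.e. the Borel
   sigma-algebra. measurableTypeR R is R with the measurable structure on which
   lebesgue_measure is defined. *)
Notation Rvec R d := (d.-tuple (measurableTypeR R)).

Definition tuple_cons (T : Type) (n : nat) (z : T * n.-tuple T) :
  n.+1.-tuple T := [tuple of z.1 :: z.2].

(* n-fold product mu \x ... \x mu, carried by n.-tuple T. *)
Fixpoint power_measure (R : realType) (disp : measure_display)
    (T : measurableType disp) (mu : set T -> \bar R) (n : nat) :
    set (n.-tuple T) -> \bar R :=
  if n is m.+1
  then pushforward (mu \x power_measure mu (n := m))%E (@tuple_cons T m)
  else \d_([tuple] : 0.-tuple T).
Arguments power_measure {R disp T} mu n.

Lemma measurable_tuple_cons (disp : measure_display) (T : measurableType disp)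
    (n : nat) : measurable_fun setT (@tuple_cons T n).
Proof. exact: measurable_cons. Qed.

Lemma power_measure_sigma_finite (R : realType) (disp : measure_display)
    (T : measurableType disp) (mu : {sigma_finite_measure set T -> \bar R})
    (n : nat) :
  exists m : {sigma_finite_measure set (n.-tuple T) -> \bar R},
    power_measure mu n = m.
Proof.
elim: n => [|n [m IHm]] /=; first by exists (\d_([tuple] : 0.-tuple T)).
rewrite IHm.
pose mm : {measure set (T * n.-tuple T)%type -> \bar R} := (mu \x m)%E.
pose nu := pushforward mm (@tuple_cons T n).
have nu0 : nu set0 = 0%E by rewrite /nu /pushforward preimage_set0 measure0.
have mf := @measurable_tuple_cons _ T n.
have nuge A : (0 <= nu A)%E by exact: measure_ge0.
have nus : semi_sigma_additive nu.
  exact: (@measure_semi_sigma_additive _ _ _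
    (measure_function_pushforward__canonical__measure_function_Measure mm mf)).
have nusf : sigma_finite setT nu.
  have [F FT mF] : sigma_finite setT mm.
    have /sigma_finiteP[F [TF ndF Foo]] := sigma_finiteT mu.
    have /sigma_finiteP[G [TG ndG Goo]] := sigma_finiteT m.
    exists (fun n => F n `*` G n).
      rewrite -setXTT TF TG predeqE => -[x y]; split.
        move=> [/= [i _ Fnx] [k _ Gky]]; exists (maxn i k) => //; split.
        - by move: x Fnx; exact/subsetPset/ndF/leq_maxl.
        - by move: y Gky; exact/subsetPset/ndG/leq_maxr.
      by move=> [i _ []/= ? ?]; split; exists i.
    move=> k; have [? ?] := Foo k; have [? ?] := Goo k.
    split; first exact: measurableX.
    by rewrite /mm /= product_measure1E// lte_mul_pinfty// ge0_fin_numE.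
  pose g (t : n.+1.-tuple T) : (T * n.-tuple T)%type := (thead t, [tuple of behead t]).
  have mg : measurable_fun setT g.
    apply/measurable_fun_pair => //.
      exact: measurable_tnth.
    exact: measurable_behead.
  exists (fun i => g @^-1` F i) => [|i].
    by rewrite -preimage_bigcup -FT preimage_setT.
  have [mFi Fi] := mF i; split.
    by rewrite -[X in measurable X]setTI; exact: mg.
  rewrite /nu /pushforward -comp_preimage (_ : g \o _ = id) //.
  by apply/funext => -[x t] /=; rewrite /g /tuple_cons/=; congr (_, _); apply: val_inj.
pose M : {measure set (n.+1.-tuple T) -> \bar R} :=
  measure_function_pushforward__canonical__measure_function_Measure mm mf.
pose S := Measure_isSigmaFinite.Build _ _ _ M nusf.
by exists (HB.pack_for {sigma_finite_measure set (n.+1.-tuple T) -> \bar R}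
             (Measure.sort M) S).
Qed.

Lemma power_measure_box (R : realType) (disp : measure_display)
    (T : measurableType disp) (mu : {sigma_finite_measure set T -> \bar R})
    (n : nat) (A : 'I_n -> set T) :
  (forall i, measurable (A i)) ->
  power_measure mu n [set t | forall i, A i (tnth t i)] = (\prod_(i < n) mu (A i))%E.
Proof.
elim: n A => [|n IH] A mA.
  by rewrite big_ord0 /= diracE mem_set// => -[].
rewrite big_ord_recl -IH //= /pushforward.
have [m ->] := power_measure_sigma_finite mu n.
have mB : measurable
    [set t : n.-tuple T | forall i, A (lift ord0 i) (tnth t i)].
  rewrite (_ : [set _ | _] = \bigcap_(i in [set: 'I_n])
    ((@tnth _ T ^~ i) @^-1` (A (lift ord0 i)))); last first.
    by apply/seteqP; split => t /= h i; [move=> _; exact: h|exact: (h i)].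
  apply: fin_bigcap_measurable => // i _.
  by rewrite -[X in measurable X]setTI; exact: measurable_tnth.
rewrite -product_measure1E //; congr (_ _).
apply/seteqP; split => -[x t] /=.
  move=> h; split; first exact: (h ord0).
  by move=> i; have := h (lift ord0 i); rewrite /tuple_cons tnthS.
move=> [h0 h] i; case: (unliftP ord0 i) => [j ->|->] //.
by rewrite /tuple_cons tnthS; exact: h.
Qed.

Definition lebesgue_vec (R : realType) (d : nat) : set (Rvec R d) -> \bar R :=
  power_measure lebesgue_measure d.
Arguments lebesgue_vec {R d}.

(* Euclidean norm; the norm that the library puts on 'rV[R]_d is the sup norm. *)
Definition enorm (R : realType) (d : nat) (u : Rvec R d) : R :=
  Num.sqrt (\sum_(i < d) (tnth u i : R) ^+ 2).

Definition gaussian_mixture (R : realType) (d : nat)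
    (G : probability (Rvec R d) R) (x : Rvec R d) : R :=
  \int[G]_u (\prod_(i < d) normal_pdf 0 1 ((tnth x i : R) - tnth u i)).

Definition mixture_class (R : realType) (d : nat)
    (GG : set (probability (Rvec R d) R)) : set (Rvec R d -> R) :=
  [set gaussian_mixture G | G in GG].

Definition bounded_moment (R : realType) (d : nat) (p K : R) :
    set (probability (Rvec R d) R) :=
  [set G : probability (Rvec R d) R |
     ((\int[G]_u (enorm u `^ p)%:E) `^ p^-1 <= K%:E)%E].
Arguments bounded_moment {R} d p K.

Definition hellinger2 (R : realType) (d : nat) (f g : Rvec R d -> R) : \bar R :=
  (\int[lebesgue_vec]_x ((Num.sqrt (f x) - Num.sqrt (g x)) ^+ 2)%:E)%E.

Definition density_law (R : realType) (d : nat) (f : Rvec R d -> R) :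
    set (Rvec R d) -> \bar R :=
  fun A => (\int[lebesgue_vec]_(x in A) (f x)%:E)%E.

(* Joint measurability in (data, point) makes the loss a measurable function of
   the data. The estimate need not be a density nor even integrable. *)
Definition estimator (R : realType) (d n : nat) :
    set (n.-tuple (Rvec R d) -> Rvec R d -> R) :=
  [set fhat : n.-tuple (Rvec R d) -> Rvec R d -> R |
     measurable_fun setT
       (fun z : n.-tuple (Rvec R d) * Rvec R d => fhat z.1 z.2) /\
     (forall X x, 0 <= fhat X x)].
Arguments estimator {R d n}.

Definition hellinger_risk (R : realType) (d n : nat)
    (fhat : n.-tuple (Rvec R d) -> Rvec R d -> R) (f : Rvec R d -> R) :
    \bar R :=
  (\int[power_measure (density_law f) n]_X hellinger2 (fhat X) f)%E.

Definition minimax_risk (R : realType) (d n : nat) (F : set (Rvec R d -> R)) :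
    \bar R :=
  ereal_inf [set ereal_sup [set hellinger_risk fhat f | f in F]
            | fhat in @estimator R d n].

(* Main.v *)
Require Import Defs.
From HB Require Import structures.
From mathcomp Require Import all_boot all_order all_algebra.
From mathcomp Require Import all_classical all_reals all_analysis.
From mathcomp Require Import measurable_realfun ring lra.
Set Implicit Arguments.
Unset Strict Implicit.
Unset Printing Implicit Defensive.
Import Order.TTheory GRing.Theory Num.Theory.
Import numFieldNormedType.Exports.
Local Open Scope classical_set_scope.
Local Open Scope ring_scope.

(** The lower bound comes from a hypercube of mixtures in which each coordinate
    is an atom of mass of order 1/n that is present or absent.

    Fix a lattice of N sites, all at mutual distance at least L and at distance
    at least L from the origin, with L of order log n.  For a set tau of sites
    let f_tau be the Gaussian mixture whose mixing measure puts mass w on every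
    site of tau and the remaining mass at the origin ([spike_mixture]).

    Adding a site j to tau only removes w phi(x) from the density and adds a
    nonnegative term.  As the origin keeps at least half of the mass,
    w phi <= 2 w f_tau, so f_(j + tau) >= (1 - 2 w) f_tau pointwise.  The laws
    of the samples therefore satisfy P_(j + tau)^n >= (1 - 2 w)^n P_tau^n
    >= P_tau^n / 2 as soon as n w <= 1/4 ([power_measure_homo],
    [bernoulli_ineq]): the presence of a single atom cannot be detected
    reliably.  This domination replaces the usual Hellinger affinity.

    The presence of the atom matters on the unit cube at j: there f_tau is at
    least w times a constant if j is in tau, and otherwise it is at most
    exp(-(L - 1)), which the choice of L makes a quarter of that or less.  So
    the square roots of the two densities differ by a constant times sqrt w on
    the cube, whatever the rest of tau.  The cubes are disjoint, so the local
    losses add up, and averaging over all tau ([assouad_hellinger]) gives a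
    minimax risk of order N w ([packing_lower_bound]).

    It remains to make N as large as the moment constraint allows.  With
    N = m^d lattice points of spacing L in the positive orthant
    ([grid_lower_bound]) and w of order 1/n, the p-th moment is at most of order
    m^d (L m)^p / n.  It stays bounded for m of order n^(1/(p+d)) / L, and then
    N w is of order n^(-p/(p+d)) (log n)^(-d), which is larger than required. *)

(** * Product measures, densities and finitely supported probabilities *)

(** Both product measures are iterated integrals of the same section functions,
    so the induction compares the inner measures first, pointwise in the outer
    variable, and then the outer ones. *)
Lemma power_measure_homo (R : realType) (disp : measure_display)
    (T : measurableType disp) (P Q : {sigma_finite_measure set T -> \bar R})
    (c : R) (n : nat) : 0 <= c ->
  (forall A, measurable A -> c%:E * P A <= Q A)%E ->
  forall A, measurable A ->
    ((c ^+ n)%:E * power_measure P n A <= power_measure Q n A)%E.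
Proof.
move=> c0 PQ; elim: n => [|n IHn] A mA /=; first by rewrite expr0 mul1e.
have [Pn PnE] := power_measure_sigma_finite P n.
have [Qn QnE] := power_measure_sigma_finite Q n.
move: IHn; rewrite PnE QnE => IHn; rewrite /pushforward /product_measure1.
have mB : measurable (@tuple_cons T n @^-1` A).
  by rewrite -[X in measurable X]setTI; exact: measurable_tuple_cons.
set B := _ @^-1` A.
have mxP := measurable_fun_xsection Pn mB.
have mxQ := measurable_fun_xsection Qn mB.
pose cn := NngNum (exprn_ge0 n c0).
apply: (@le_trans _ _ (c%:E * \int[P]_x (cn%:num%:E * (Pn \o xsection B) x))%E).
  by rewrite ge0_integralZl_EFin ?exprn_ge0//= exprS EFinM muleA.
apply: (@le_trans _ _ (c%:E * \int[P]_x ((Qn \o xsection B) x))%E).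
  rewrite lee_wpmul2l ?lee_fin// ge0_le_integral//=.
  - by move=> x _; rewrite mule_ge0 ?lee_fin ?exprn_ge0.
  - exact: measurable_funeM.
  - by move=> x _; apply: IHn; exact: measurable_xsection.
pose cc := NngNum c0.
rewrite -[c%:E]/(cc%:num%:E) -ge0_integral_mscale//.
exact: ge0_le_measure_integral.
Qed.

Lemma density_law_probability (R : realType) (d : nat) (f : Rvec R d -> R) :
  measurable_fun setT f -> (forall x, 0 <= f x) ->
  (\int[lebesgue_vec]_x (f x)%:E = 1)%E ->
  exists P : probability (Rvec R d) R, density_law f = P.
Proof.
move=> mf f0; rewrite /density_law /lebesgue_vec.
have [mu ->] := power_measure_sigma_finite (@lebesgue_measure R) d.
move=> f1.
pose nu (A : set (Rvec R d)) := (\int[mu]_(x in A) (f x)%:E)%E.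
have nu0 : nu set0 = 0%E by rewrite /nu integral_set0.
have nu_ge0 A : (0 <= nu A)%E by apply: integral_ge0 => x _; rewrite lee_fin.
have nu_sigma : semi_sigma_additive nu.
  move=> A mA tA mUA; rewrite /nu ge0_integral_bigcup//=.
  - by apply: is_cvg_ereal_nneg_natsum_cond => n _ _; exact: nu_ge0.
  - by apply/measurable_EFinP; exact: measurable_funTS.
  - by move=> x _; rewrite lee_fin.
pose Mm := isMeasure.Build _ _ _ nu nu0 nu_ge0 nu_sigma.
pose M : {measure set (Rvec R d) -> \bar R} := HB.pack nu Mm.
pose Mp := Measure_isProbability.Build _ _ _ M f1.
by exists (HB.pack_for (probability (Rvec R d) R) (Measure.sort M) Mp).
Qed.

(** Only the integral formula is kept: the mixing measures are used only
    through their integrals against the Gaussian kernel and against the moment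
    function. *)
Lemma finite_support_probability (R : realType) (disp : measure_display)
    (T : measurableType disp) (J : finType) (wt : J -> R) (b : J -> T) :
  (forall j, 0 <= wt j) -> \sum_j wt j = 1 ->
  exists G : probability T R, forall g : T -> \bar R,
    measurable_fun setT g -> (forall x, 0 <= g x)%E ->
    (\int[G]_x g x = \sum_j (wt j)%:E * g (b j))%E.
Proof.
move=> wt0 wt1.
have J0 : (0 < #|J|)%N.
  rewrite lt0n; apply/negP => /eqP/card0_eq J0.
  by move: wt1; rewrite big_pred0// => /eqP; rewrite eq_sym oner_eq0.
have j0 : J by move/card_gt0P : J0 => /cid[].
pose idx (k : nat) : J := nth j0 (enum J) k.
pose m (k : nat) : {measure set T -> \bar R} :=
  mscale (NngNum (wt0 (idx k))) (\d_(b (idx k)) : {measure set T -> \bar R}).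
pose M : {measure set T -> \bar R} := msum m #|J|.
have ME (g : T -> \bar R) : measurable_fun setT g -> (forall x, 0 <= g x)%E ->
    (\int[M]_x g x = \sum_j (wt j)%:E * g (b j))%E.
  move=> mg g0; rewrite ge0_integral_measure_sum//.
  rewrite [RHS](reindex_onto (enum_val : 'I_#|J| -> J) enum_rank)/=; last first.
    by move=> j _; rewrite enum_rankK.
  apply: eq_big => [k|k _]; first by rewrite enum_valK eqxx.
  rewrite ge0_integral_mscale//= integral_dirac// diracT mul1e.
  by rewrite /idx (enum_val_nth j0).
have M1 : M setT = 1%E.
  rewrite -[LHS]mul1e -(@integral_cst _ _ _ M setT measurableT 1) ME//.
  under eq_bigr do rewrite mule1.
  by rewrite sumEFin wt1.
pose Mp := Measure_isProbability.Build _ _ _ M M1.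
by exists (HB.pack_for (probability T R) (Measure.sort M) Mp).
Qed.

(** Tonelli, peeling off one coordinate at a time. *)
Lemma integral_lebesgue_vec_prod (R : realType) (d : nat) (g : 'I_d -> R -> R) :
  (forall i, measurable_fun [set: measurableTypeR R] (g i)) ->
  (forall i x, 0 <= g i x) ->
  (\int[@lebesgue_vec R d]_x (\prod_(i < d) g i (tnth x i))%:E =
   \prod_(i < d) \int[@lebesgue_measure R]_x (g i x)%:E)%E.
Proof.
rewrite /lebesgue_vec; elim: d g => [|d IHd] g mg g0 /=.
  under eq_integral do rewrite big_ord0.
  by rewrite big_ord0 integral_dirac// diracT mule1.
have mprod k (h : 'I_k -> R -> R) :
    (forall i, measurable_fun [set: measurableTypeR R] (h i)) ->
    measurable_fun [set: Rvec R k] (fun x => (\prod_(i < k) h i (tnth x i))%:E).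
  move=> mh; apply/measurable_EFinP; apply: measurable_prod => i _.
  by apply: measurableT_comp => //; exact: measurable_tnth.
have pge0 k (h : 'I_k -> R -> R) (x : Rvec R k) : (forall i x, 0 <= h i x) ->
    (0 <= (\prod_(i < k) h i (tnth x i))%:E)%E.
  by move=> h0; rewrite lee_fin prodr_ge0.
rewrite big_ord_recl -IHd//.
have [m ->] := power_measure_sigma_finite (@lebesgue_measure R) d.
rewrite (@ge0_integral_pushforward _ _ _ _ R _
  (@measurable_tuple_cons _ (measurableTypeR R) d))//=.
- rewrite preimage_setT fubini_tonelli1/=; last 2 first.
  + apply: (measurableT_comp (mprod _ g mg)).
    exact: measurable_tuple_cons.
  + by move=> x; exact: pge0.
  rewrite /fubini_F/=.
  transitivity (\int[lebesgue_measure]_x ((g ord0 x)%:E *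
     \int[m]_y (\prod_(i < d) g (lift ord0 i) (tnth y i))%:E)%E)%E.
    apply: eq_integral => x _.
    rewrite -ge0_integralZl_EFin//; last 2 first.
    + by move=> y _; exact: (pge0 _ (fun i => g (lift ord0 i))).
    + exact: (mprod _ (fun i => g (lift ord0 i))).
    apply: eq_integral => y _; rewrite big_ord_recl EFinM; congr (_%:E * _%:E)%E.
    by apply: eq_bigr => i _; rewrite /tuple_cons tnthS.
  rewrite ge0_integralZr//.
  + exact/measurable_EFinP.
  + by move=> x _; rewrite lee_fin.
  + apply: integral_ge0 => y _; exact: (pge0 _ (fun i => g (lift ord0 i))).
- exact: mprod.
- by move=> y _; exact: pge0.
Qed.

(** * Lower bounds by comparing pairs of hypotheses *)

(** Tonelli's theorem makes the loss on a set B measurable in the data; the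
    restriction to B is moved into the integrand by an indicator. *)
Lemma measurable_fun_partial_integral (R : realType) (d1 d2 : measure_display)
    (T : measurableType d1) (U : measurableType d2)
    (mu : {sigma_finite_measure set U -> \bar R}) (g : T -> U -> R)
    (B : set U) :
  measurable_fun setT (fun z : T * U => g z.1 z.2) ->
  (forall t x, 0 <= g t x) -> measurable B ->
  measurable_fun setT (fun t => \int[mu]_(x in B) (g t x)%:E)%E.
Proof.
move=> mg g0 mB.
pose k (z : T * U) : \bar R := (g z.1 z.2 * \1_B z.2)%:E.
have mk : measurable_fun setT k.
  apply/measurable_EFinP; apply: measurable_funM => //.
  exact: measurableT_comp.
have k0 z : (0 <= k z)%E by rewrite lee_fin mulr_ge0.
have := @measurable_fun_fubini_tonelli_F d1 d2 T U R mu k mk k0.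
rewrite (_ : fubini_F _ _ = fun t => \int[mu]_(x in B) (g t x)%:E)%E//.
apply/funext => t; rewrite /fubini_F [RHS]integral_mkcond.
by apply: eq_integral => x _; rewrite epatch_indic.
Qed.

(** Both P and Q dominate kappa P, so both losses may be integrated against
    kappa P, where (s - a)^2 + (s - b)^2 >= (b - a)^2 / 2 >= h^2 / 2 whatever the estimate s. *)
Lemma two_point_lower_bound (R : realType) (d1 d2 : measure_display)
    (T : measurableType d1) (U : measurableType d2)
    (P Q : {measure set T -> \bar R})
    (mu : {sigma_finite_measure set U -> \bar R})
    (s : T -> U -> R) (a b : U -> R) (B : set U) (kappa h : R) :
  0 <= kappa <= 1 -> P setT = 1%E ->
  (forall A, measurable A -> kappa%:E * P A <= Q A)%E ->
  measurable_fun setT (fun z : T * U => s z.1 z.2) ->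
  measurable_fun setT a -> measurable_fun setT b ->
  measurable B -> mu B = 1%E -> 0 <= h ->
  (forall x, B x -> a x <= h) -> (forall x, B x -> 2 * h <= b x) ->
  ((kappa * (h ^+ 2 / 2))%:E <=
   \int[P]_t \int[mu]_(x in B) ((s t x - a x) ^+ 2)%:E +
   \int[Q]_t \int[mu]_(x in B) ((s t x - b x) ^+ 2)%:E)%E.
Proof.
move=> /andP[k0 k1] P1 PQ ms ma mb mB B1 h0 ah hb.
have mloss (c : U -> R) : measurable_fun setT c ->
    measurable_fun setT (fun t => \int[mu]_(x in B) ((s t x - c x) ^+ 2)%:E)%E.
  move=> mc; apply: (@measurable_fun_partial_integral _ _ _ _ _ mu
    (fun t x => (s t x - c x) ^+ 2)) => //; last by move=> *; exact: sqr_ge0.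
  apply: measurable_funX; apply: measurable_funB => //.
  exact: measurableT_comp.
have msec (c : U -> R) t : measurable_fun setT c ->
    measurable_fun B (fun x => ((s t x - c x) ^+ 2)%:E).
  move=> mc; apply/measurable_EFinP; apply: measurable_funTS.
  apply: measurable_funX; apply: measurable_funB => //.
  exact: (measurable_fun_pair2 t ms).
have loss0 (c : U -> R) t : (0 <= \int[mu]_(x in B) ((s t x - c x) ^+ 2)%:E)%E.
  by apply: integral_ge0 => x _; rewrite lee_fin sqr_ge0.
pose kk := NngNum k0.
apply: (@le_trans _ _
  (kappa%:E * \int[P]_t \int[mu]_(x in B) ((s t x - a x) ^+ 2)%:E +
   kappa%:E * \int[P]_t \int[mu]_(x in B) ((s t x - b x) ^+ 2)%:E)%E); last first.
  apply: leeD.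
    by rewrite gee_pMl// integral_ge0.
  rewrite -[kappa%:E]/(kk%:num%:E) -ge0_integral_mscale//; last exact: mloss.
  by apply: ge0_le_measure_integral => //; exact: mloss.
rewrite -muleDr//; last first.
  by rewrite ge0_adde_def// inE; apply: integral_ge0.
rewrite -ge0_integralD//; [|exact: mloss|exact: mloss].
rewrite EFinM lee_wpmul2l ?lee_fin//.
rewrite -[leLHS]mule1 -P1 -integral_cst//.
apply: ge0_le_integral => //.
- by move=> t _; rewrite lee_fin divr_ge0 ?sqr_ge0.
- by apply: emeasurable_funD; exact: mloss.
move=> t _ /=; rewrite -ge0_integralD//; last 4 first.
- by move=> x _; rewrite lee_fin sqr_ge0.
- exact: msec.
- by move=> x _; rewrite lee_fin sqr_ge0.
- exact: msec.
rewrite -[leLHS]mule1 -B1 -integral_cst//.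
apply: ge0_le_integral => //.
- by move=> x _; rewrite lee_fin divr_ge0 ?sqr_ge0.
- by apply: emeasurable_funD; exact: msec.
move=> x Bx /=; rewrite -EFinD lee_fin.
have hba : h <= b x - a x by have := ah x Bx; have := hb x Bx; lra.
have hba2 : h ^+ 2 <= (b x - a x) ^+ 2.
  by rewrite ler_sqr ?nnegrE// (le_trans h0).
(* The parallelogram identity for s - a and s - b. *)
have := sqr_ge0 ((s t x - a x) + (s t x - b x)).
move: hba2; rewrite !expr2; lra.
Qed.

Definition toggle (J : finType) (j : J) (tau : {set J}) : {set J} :=
  if j \in tau then tau :\ j else j |: tau.

Lemma toggleK (J : finType) (j : J) : involutive (toggle j).
Proof.
move=> tau; rewrite /toggle; have [jt|jt] := boolP (j \in tau).
  by rewrite !inE eqxx/= finset.setD1K.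
by rewrite !inE eqxx/= finset.setU1K.
Qed.

(** Assouad's argument.  The loss is at least the sum over j of the losses on
    B j.  For fixed j, toggle j pairs each tau with the hypothesis differing
    from it at j only, and [two_point_lower_bound] gives h^2 / 4 for the pair.
    Each tau lies in one pair, and is counted twice when the pair sum is taken
    over all tau, whence h^2 / 8 on average over tau for each j. *)
Lemma assouad_hellinger (R : realType) (d n : nat) (J : finType)
    (f : {set J} -> Rvec R d -> R) (B : J -> set (Rvec R d))
    (F : set (Rvec R d -> R)) (rho h : R) :
  (forall tau, F (f tau)) ->
  (forall tau, measurable_fun setT (f tau)) ->
  (forall tau x, 0 <= f tau x) ->
  (forall tau, \int[lebesgue_vec]_x (f tau x)%:E = 1)%E ->
  (forall j, measurable (B j)) -> (forall j, lebesgue_vec (B j) = 1%E) ->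
  trivIset setT B ->
  0 <= rho -> 2^-1 <= rho ^+ n -> 0 <= h ->
  (forall (tau : {set J}) j x, j \notin tau -> rho * f tau x <= f (j |: tau) x) ->
  (forall (tau : {set J}) j x, j \notin tau -> B j x ->
    Num.sqrt (f tau x) <= h) ->
  (forall (tau : {set J}) j x, j \in tau -> B j x ->
    2 * h <= Num.sqrt (f tau x)) ->
  ((#|J|%:R * (h ^+ 2 / 8))%:E <= minimax_risk n F)%E.
Proof.
move=> Ff mf f0 f1 mB B1 tB rho0 rhon h0 frho flow fhigh.
apply: le_ereal_inf_tmp => _ [fhat [mfhat fhat0] <-].
set S := ereal_sup _.
have mrho tau : exists P : probability (Rvec R d) R, density_law (f tau) = P.
  exact: density_law_probability.
have [P PE] := choice mrho.
have mPn tau :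
    exists Q : {sigma_finite_measure set (n.-tuple (Rvec R d)) -> \bar R},
    power_measure (P tau) n = Q.
  exact: power_measure_sigma_finite.
have [Pn PnE] := choice mPn.
have Pn1 tau : Pn tau setT = 1%E.
  rewrite -PnE (_ : setT = [set t | forall i, setT (tnth t i)]).
    rewrite (@power_measure_box _ _ _ (P tau) n (fun=> setT))//.
    by rewrite big1// => i _; exact: probability_setT.
  by apply/seteqP; split.
move: f1 B1; rewrite /lebesgue_vec => f1 B1.
have [mu muE] := power_measure_sigma_finite (@lebesgue_measure R) d.
have PPle (tau : {set J}) j : j \notin tau -> forall A, measurable A ->
    ((rho%:E * P tau A) <= P (j |: tau) A)%E.
  move=> jt A mA; rewrite -!PE /density_law /lebesgue_vec muE.
  have mfA t : measurable_fun A (fun x => (f t x)%:E).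
    by apply/measurable_EFinP; exact: measurable_funTS.
  rewrite -ge0_integralZl_EFin//; last by move=> x _; rewrite lee_fin.
  apply: ge0_le_integral => //.
  - by move=> x _; rewrite -EFinM lee_fin mulr_ge0.
  - exact: measurable_funeM.
  - by move=> x _; rewrite -EFinM lee_fin; exact: frho.
have Pnle (tau : {set J}) j : j \notin tau -> forall A, measurable A ->
    ((2^-1)%:E * Pn tau A <= Pn (j |: tau) A)%E.
  move=> jt A mA; apply: (@le_trans _ _ ((rho ^+ n)%:E * Pn tau A)%E).
    by rewrite lee_wpmul2r// lee_fin.
  by rewrite -!PnE; apply: power_measure_homo => //; exact: PPle.
pose s (X : n.-tuple (Rvec R d)) x := Num.sqrt (fhat X x).
have msqrt : measurable_fun [set: R] (@Num.sqrt R).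
  by apply: continuous_measurable_fun; exact: sqrt_continuous.
have ms : measurable_fun setT
    (fun z : n.-tuple (Rvec R d) * Rvec R d => s z.1 z.2).
  exact: (measurableT_comp msqrt mfhat).
have mr tau : measurable_fun setT (fun x => Num.sqrt (f tau x)).
  exact: (measurableT_comp msqrt (mf tau)).
pose loss tau j X :=
  (\int[mu]_(x in B j) ((s X x - Num.sqrt (f tau x)) ^+ 2)%:E)%E.
have mloss tau j : measurable_fun setT (loss tau j).
  apply: (@measurable_fun_partial_integral _ _ _ _ _ mu
    (fun t x => (s t x - Num.sqrt (f tau x)) ^+ 2)) => //.
    apply: measurable_funX; apply: measurable_funB => //.
    exact: (measurableT_comp (mr tau) measurable_snd).
  by move=> *; exact: sqr_ge0.
have loss0 tau j X : (0 <= loss tau j X)%E.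
  by apply: integral_ge0 => x _; rewrite lee_fin sqr_ge0.
(* The full loss dominates the local ones because the cells are disjoint. *)
have riskS tau : (\sum_(j : J) \int[Pn tau]_X loss tau j X <= S)%E.
  apply: le_trans (ereal_sup_ubound _); last by exists (f tau).
  rewrite /hellinger_risk PE PnE /hellinger2 /lebesgue_vec muE.
  rewrite -ge0_integral_sum//; apply: ge0_le_integral => //.
  - by move=> X _; exact: sume_ge0.
  - exact: emeasurable_sum.
  - apply: (@measurable_fun_partial_integral _ _ _ _ _ mu
      (fun t x => (s t x - Num.sqrt (f tau x)) ^+ 2)) => //.
      apply: measurable_funX; apply: measurable_funB => //.
      exact: (measurableT_comp (mr tau) measurable_snd).
    by move=> *; exact: sqr_ge0.
  move=> X _.
  have mX D : measurable_fun D (fun x => ((s X x - Num.sqrt (f tau x)) ^+ 2)%:E).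
    apply/measurable_EFinP; apply: measurable_funTS.
    apply: measurable_funX; apply: measurable_funB => //.
    exact: (measurable_fun_pair2 X ms).
  rewrite /loss -ge0_integral_bigsetU//.
  - apply: ge0_subset_integral => //.
    + exact: bigsetU_measurable.
    + by move=> x _; rewrite lee_fin sqr_ge0.
  - exact: index_enum_uniq.
  - exact: sub_trivIset tB.
  - by move=> x _; rewrite lee_fin sqr_ge0.
have pair tau j : ((h ^+ 2 / 4)%:E <=
    \int[Pn tau]_X loss tau j X +
    \int[Pn (toggle j tau)]_X loss (toggle j tau) j X)%E.
  have pairU (t : {set J}) : j \notin t -> ((h ^+ 2 / 4)%:E <=
      \int[Pn t]_X loss t j X + \int[Pn (j |: t)]_X loss (j |: t) j X)%E.
    move=> jt; have -> : h ^+ 2 / 4 = 2^-1 * (h ^+ 2 / 2) by field.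
    apply: two_point_lower_bound => //.
    - by apply/andP; split; lra.
    - exact: Pn1.
    - exact: Pnle.
    - by rewrite -muE.
    - by move=> x; exact: flow.
    - by move=> x; apply: fhigh; rewrite finset.setU11.
  rewrite /toggle; case: ifPn => jt; last exact: pairU.
  have := pairU (tau :\ j); rewrite finset.setD1K// addeC; apply.
  by rewrite !inE eqxx.
have sumj j : ((#|{set J}|%:R * (h ^+ 2 / 8))%:E <=
    \sum_(tau : {set J}) \int[Pn tau]_X loss tau j X)%E.
  set E := (X in (_ <= X)%E).
  have E0 : (0 <= E)%E by apply: sume_ge0 => tau _; exact: integral_ge0.
  have : ((#|{set J}|%:R * (h ^+ 2 / 4))%:E <= E + E)%E.
    (* One copy of the sum over tau is reindexed by the involution toggle j. *)
    rewrite {2}/E (reindex_inj (inv_inj (toggleK j))) /E -big_split/=.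
    apply: le_trans (lee_sum _ (fun tau _ => pair tau j)).
    rewrite sumEFin sumr_const -[X in (_ <= X%:E)%E]mulr_natl.
    by rewrite (@eq_card _ xpredT {: {set J}})// => t; rewrite !inE.
  case: (E) E0 => [r| |]//=; last by move=> *; exact: leey.
  by rewrite -EFinD !lee_fin => *; lra.
have : ((#|J|%:R * (#|{set J}|%:R * (h ^+ 2 / 8)))%:E <=
    \sum_(tau : {set J}) S)%E.
  apply: le_trans (lee_sum _ (fun tau _ => riskS tau)).
  rewrite exchange_big/=.
  apply: le_trans (lee_sum _ (fun j _ => sumj j)).
  by rewrite sumEFin sumr_const -[X in (_ <= X%:E)%E]mulr_natl.
have : (0 <= S)%E.
  apply: le_trans (riskS finset.set0); apply: sume_ge0 => j _; exact: integral_ge0.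
case: (S) => [r _| |]//; last by move=> *; exact: leey.
rewrite sumEFin sumr_const !lee_fin -[r *+ _]mulr_natl mulrCA ler_pM2l//.
by rewrite ltr0n; apply/card_gt0P; exists finset.set0.
Qed.

(** * Gaussian mixtures with separated spikes *)

Lemma bernoulli_ineq (R : realFieldType) (t : R) (n : nat) :
  0 <= t <= 1 -> 1 - n%:R * t <= (1 - t) ^+ n.
Proof.
move=> /andP[t0 t1]; elim: n => [|n IHn]; first by rewrite mul0r subr0 expr0.
have n0 : 0 <= n%:R :> R by [].
apply: (@le_trans _ _ ((1 - t) * (1 - n%:R * t))); last first.
  by rewrite exprS ler_wpM2l// subr_ge0.
rewrite -natr1; nra.
Qed.

Section gaussian.
Variables (R : realType) (d : nat).
Implicit Types (a x u : Rvec R d) (y L : R).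

Lemma normal_pdf01E y :
  normal_pdf 0 1 y = normal_peak 1 * expR (- (y ^+ 2 / 2)) :> R.
Proof.
rewrite normal_pdfE ?oner_neq0// /normal_fun subr0 expr1n; congr (_ * expR _).
by rewrite mulNr.
Qed.

Lemma normal_peak1_le1 : normal_peak 1 <= 1 :> R.
Proof.
rewrite /normal_peak expr1n mul1r; have pi2 := pi_ge2 R.
have pipi : 1 <= pi *+ 2 :> R by rewrite mulr2n; lra.
rewrite invf_le1 ?sqrtr_gt0 ?(lt_le_trans _ pipi)//.
by rewrite -[leLHS]sqrtr1 ler_sqrt// (le_trans _ pipi).
Qed.

Lemma normal_pdf01_le_expR y : normal_pdf 0 1 y <= expR (- (y ^+ 2 / 2)) :> R.
Proof.
by rewrite normal_pdf01E ler_piMl ?expR_ge0// normal_peak1_le1.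
Qed.

Lemma normal_pdf01_le1 y : normal_pdf 0 1 y <= 1 :> R.
Proof.
apply: le_trans (normal_pdf01_le_expR y) _.
by rewrite -[leRHS]expR0 ler_expR oppr_le0 divr_ge0 ?sqr_ge0.
Qed.

Lemma normal_pdf01_ge y : 0 <= y <= 1 ->
  normal_pdf 0 1 1 <= normal_pdf 0 1 y :> R.
Proof.
move=> /andP[y0 y1]; rewrite !normal_pdf01E ler_wpM2l ?normal_peak_ge0//.
by rewrite ler_expR lerN2 ler_pM2r ?invr_gt0// expr1n expr_le1.
Qed.

Lemma normal_pdf01_le_tail L y : 2 <= L -> L <= `|y| ->
  normal_pdf 0 1 y <= expR (- L) :> R.
Proof.
move=> L2 Ly; apply: le_trans (normal_pdf01_le_expR y) _.
by rewrite ler_expR lerN2 -(real_normK (num_real y)); nra.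
Qed.

Definition gauss_vec a x : R :=
  \prod_(i < d) normal_pdf 0 1 (tnth x i - tnth a i : R).

Lemma gauss_vec_ge0 a x : 0 <= gauss_vec a x.
Proof. by apply: prodr_ge0 => i _; exact: normal_pdf_ge0. Qed.

Lemma gauss_vec_le_tail a x L i : 2 <= L -> L <= `|tnth x i - tnth a i : R| ->
  gauss_vec a x <= expR (- L).
Proof.
move=> L2 Li; rewrite /gauss_vec (bigD1 i)//=.
rewrite -[leRHS]mulr1 ler_pM ?normal_pdf_ge0//.
- by apply: prodr_ge0 => j _; exact: normal_pdf_ge0.
- exact: normal_pdf01_le_tail.
- by apply: prodr_ile1 => j; rewrite normal_pdf_ge0 normal_pdf01_le1.
Qed.

Lemma measurable_gauss_vec a : measurable_fun setT (gauss_vec a).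
Proof.
apply: measurable_prod => i _.
apply: (measurableT_comp (measurable_normal_pdf 0 1)).
apply: measurable_funB => //; exact: (@measurable_tnth _ (measurableTypeR R)).
Qed.

Lemma measurable_gauss_vec_center x : measurable_fun setT (gauss_vec ^~ x).
Proof.
apply: measurable_prod => i _.
apply: (measurableT_comp (measurable_normal_pdf 0 1)).
apply: measurable_funB => //; exact: (@measurable_tnth _ (measurableTypeR R)).
Qed.

Lemma integral_gauss_vec a : (\int[lebesgue_vec]_x (gauss_vec a x)%:E = 1)%E.
Proof.
rewrite (integral_lebesgue_vec_prod
  (g := fun i y => normal_pdf 0 1 (y - tnth a i : R))).
- rewrite big1// => i _; rewrite -(integral_normal_pdf (tnth a i : R) 1).
  apply: eq_integral => y _; congr (_%:E).
  by rewrite !normal_pdfE ?oner_neq0// [in RHS]normal_fun_center.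
- move=> i; apply: (measurableT_comp (measurable_normal_pdf 0 1)).
  exact: measurable_funB.
- by move=> i y; exact: normal_pdf_ge0.
Qed.

Definition cube a : set (Rvec R d) :=
  [set x | forall i, [set` `[tnth a i : R, (tnth a i : R) + 1]] (tnth x i)].

Lemma measurable_cube a : measurable (cube a).
Proof.
rewrite /cube (_ : [set _ | _] = \bigcap_(i in [set: 'I_d])
    ((@tnth _ _ ^~ i) @^-1` [set` `[tnth a i : R, (tnth a i : R) + 1]])); last first.
  by apply/seteqP; split => t /= h i; [move=> _; exact: h|exact: (h i)].
apply: fin_bigcap_measurable => // i _.
rewrite -[X in measurable X]setTI.
exact: (@measurable_tnth _ (measurableTypeR R)).
Qed.

Lemma lebesgue_cube a : lebesgue_vec (cube a) = 1%E.
Proof.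
have unit_itv (t : R) : @lebesgue_measure R [set` `[t, t + 1]] = 1%E.
  rewrite lebesgue_measure_itv/= lte_fin ltrDl ltr01.
  by rewrite -EFinD addrAC subrr add0r.
rewrite /lebesgue_vec /cube.
rewrite (@power_measure_box _ _ _ (@lebesgue_measure R) d
  (fun i => [set` `[tnth a i : R, (tnth a i : R) + 1]])).
  by apply: big1 => i _; exact: unit_itv.
by move=> i; exact: measurable_itv.
Qed.

Lemma gauss_vec_ge_cube a x : cube a x ->
  normal_pdf 0 1 1 ^+ d <= gauss_vec a x.
Proof.
move=> ax; rewrite -[in leLHS](card_ord d) -prodr_const.
apply: ler_prod => i _; rewrite normal_pdf_ge0/=.
apply: normal_pdf01_ge; move: (ax i); rewrite /= in_itv/= => /andP[].
by move=> ? ?; apply/andP; split; lra.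
Qed.

(** The cube has side 1, so a point of it is moved by at most 1 in coordinate i
    from the corner a. *)
Lemma dist_cube_separated a b x i L : cube a x ->
  L <= `|tnth a i - tnth b i : R| -> L - 1 <= `|tnth x i - tnth b i : R|.
Proof.
move=> ax Lab; move: (ax i); rewrite /= in_itv/= => /andP[ax0 ax1].
have : `|tnth a i - tnth b i : R| <= `|tnth x i - tnth b i : R| + 1.
  have -> : (tnth a i - tnth b i : R) =
    (tnth x i - tnth b i : R) - (tnth x i - tnth a i : R) by lra.
  apply: (le_trans (ler_normB _ _)); rewrite lerD2l ger0_norm; lra.
lra.
Qed.

(** The mass of the sites outside tau is put back at the origin, so that the
    total mass is 1 and the origin contributes nothing to the moments. *)
Definition spike_mixture (J : finType) (b : J -> Rvec R d) (w : R)
    (tau : {set J}) x : R :=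
  (1 - w * #|tau|%:R) * gauss_vec [tuple of nseq d 0] x +
  w * \sum_(j in tau) gauss_vec (b j) x.

Lemma measurable_spike_mixture (J : finType) (b : J -> Rvec R d) (w : R)
  (tau : {set J}) : measurable_fun setT (spike_mixture b w tau).
Proof.
rewrite /spike_mixture; under eq_fun do rewrite -big_enum/=.
apply: measurable_funD; apply: measurable_funM => //.
  exact: measurable_gauss_vec.
by apply: measurable_sum => j; exact: measurable_gauss_vec.
Qed.

Lemma integral_spike_mixture (J : finType) (b : J -> Rvec R d) (w : R)
    (tau : {set J}) : 0 <= w -> w * #|tau|%:R <= 1 ->
  (\int[lebesgue_vec]_x (spike_mixture b w tau x)%:E = 1)%E.
Proof.
move=> w0 wtau; have igauss := integral_gauss_vec.
rewrite /lebesgue_vec in igauss *.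
have [mu muE] := power_measure_sigma_finite (@lebesgue_measure R) d.
rewrite muE in igauss *.
have mg a : measurable_fun setT (fun x => (gauss_vec a x)%:E).
  by apply/measurable_EFinP; exact: measurable_gauss_vec.
have mS : measurable_fun setT
    (fun x => (\sum_(j <- enum tau) (gauss_vec (b j) x)%:E)%E).
  by apply: emeasurable_sum => j; exact: mg.
have g0 a x : (0 <= (gauss_vec a x)%:E)%E by rewrite lee_fin gauss_vec_ge0.
have S0 x : (0 <= \sum_(j <- enum tau) (gauss_vec (b j) x)%:E)%E.
  by apply: sume_ge0 => j _; exact: g0.
have al0 : 0 <= 1 - w * #|tau|%:R by rewrite subr_ge0.
transitivity (\int[mu]_x
    ((1 - w * #|tau|%:R)%:E * (gauss_vec [tuple of nseq d 0] x)%:E +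
     w%:E * \sum_(j <- enum tau) (gauss_vec (b j) x)%:E))%E.
  by apply: eq_integral => x _; rewrite /spike_mixture -big_enum/= sumEFin.
rewrite ge0_integralD//; last 4 first.
- by move=> x _; rewrite mule_ge0.
- exact: measurable_funeM.
- by move=> x _; rewrite mule_ge0.
- exact: measurable_funeM.
rewrite !ge0_integralZl_EFin// igauss ge0_integral_sum//.
under eq_bigr do rewrite igauss.
rewrite sumEFin big_enum/= sumr_const mule1 -EFinM -EFinD.
by congr (_%:E); lra.
Qed.

Lemma spike_mixture_in_class (J : finType) (b : J -> Rvec R d) (w p K M : R)
    (tau : {set J}) : 0 < p -> 0 <= K -> 0 <= w -> 0 <= M ->
  #|J|%:R * w <= 1 ->
  (forall j, enorm (b j) `^ p <= M) -> #|J|%:R * w * M <= K `^ p ->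
  mixture_class (bounded_moment d p K) (spike_mixture b w tau).
Proof.
move=> p0 K0 w0 M0 Nw bM NwM.
have tauN : w * #|tau|%:R <= #|J|%:R * w.
  by rewrite mulrC ler_wpM2r// ler_nat max_card.
pose wt (o : 'I_1 + J) : R := match o with
  | inl _ => 1 - w * #|tau|%:R | inr j => if j \in tau then w else 0 end.
pose c (o : 'I_1 + J) : Rvec R d := match o with
  | inl _ => [tuple of nseq d 0] | inr j => b j end.
have sumwt : \sum_(j : J) (if j \in tau then w else 0) = w * #|tau|%:R.
  by rewrite -big_mkcond/= sumr_const mulr_natr.
have [|| G GE] := @finite_support_probability R _ (Rvec R d) ('I_1 + J)%type wt c.
- by move=> [_|j]/=; [rewrite subr_ge0 (le_trans tauN)|case: ifP].
- by rewrite big_sumType/= big_ord1 sumwt subrK.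
exists G.
- rewrite /bounded_moment/=.
  have -> : (\int[G]_u (enorm u `^ p)%:E =
      (\sum_(j in tau) w * enorm (b j) `^ p)%:E)%E.
    rewrite GE; last 2 first.
    + apply/measurable_EFinP.
      apply: (measurableT_comp (measurable_powR p)).
      apply: (measurableT_comp (f := @Num.sqrt R)).
        by apply: continuous_measurable_fun; exact: sqrt_continuous.
      apply: measurable_sum => i; apply: measurable_funX.
      exact: (@measurable_tnth _ (measurableTypeR R)).
    + by move=> u; rewrite lee_fin powR_ge0.
    rewrite big_sumType/= big_ord1/= (_ : enorm _ = 0); last first.
      rewrite /enorm big1 ?sqrtr0// => i _.
      by rewrite tnth_nseq expr0n.
    rewrite powR0 ?gt_eqF// mule0 add0e [in RHS]big_mkcond/= -sumEFin.
    apply: eq_bigr => j _; case: ifP => _; first by rewrite EFinM.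
    by rewrite mul0e.
  rewrite poweR_EFin lee_fin.
  have -> : K = (K `^ p) `^ p^-1 by rewrite -powRrM divff ?gt_eqF// powRr1.
  rewrite ge0_ler_powR ?invr_ge0 ?nnegrE ?powR_ge0 ?(ltW p0)//.
    by apply: sumr_ge0 => j _; rewrite mulr_ge0 ?powR_ge0.
  apply: le_trans NwM.
  apply: (@le_trans _ _ (\sum_(j in tau) w * M)).
    by apply: ler_sum => j _; rewrite ler_wpM2l.
  by rewrite sumr_const -[X in X <= _]mulr_natr mulrAC ler_wpM2r.
- apply/funext => x; rewrite /gaussian_mixture /Rintegral.
  rewrite (_ : (\int[G]_u _)%E = (\int[G]_u (gauss_vec u x)%:E)%E)//.
  rewrite GE; last 2 first.
  + by apply/measurable_EFinP; exact: measurable_gauss_vec_center.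
  + by move=> u; rewrite lee_fin gauss_vec_ge0.
  under eq_bigr do rewrite -EFinM.
  rewrite sumEFin/= big_sumType/= big_ord1/= /spike_mixture mulr_sumr.
  congr (_ + _); rewrite [RHS]big_mkcond/=.
  by apply: eq_bigr => j _; case: ifP => //; rewrite mul0r.
Qed.

(** The tail exponent is linear in L because L - 1 >= 2 makes (L - 1)^2 / 2 at
    least L - 1; the factor 4 in the comparison with w makes the square root of
    the density without the spike at most half of the one with it. *)
Lemma packing_lower_bound (n : nat) (J : finType) (b : J -> Rvec R d)
    (p K w L M : R) :
  (0 < n)%N -> 0 < p -> 0 <= K -> 0 <= w -> 0 <= M -> 3 <= L ->
  #|J|%:R * w <= 2^-1 -> n%:R * w <= 4^-1 ->
  (forall j k, j != k -> exists i, L <= `|tnth (b j) i - tnth (b k) i : R|) ->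
  (forall j, exists i, L <= `|tnth (b j) i : R|) ->
  4 * expR (- (L - 1)) <= w * normal_pdf 0 1 1 ^+ d ->
  (forall j, enorm (b j) `^ p <= M) -> #|J|%:R * w * M <= K `^ p ->
  ((#|J|%:R * (w * normal_pdf 0 1 1 ^+ d / 32))%:E <=
   minimax_risk n (mixture_class (bounded_moment d p K)))%E.
Proof.
move=> n0 p0 K0 w0 M0 L3 Nw nw sepb sep0 Lw bM NwM.
set c0 := normal_pdf 0 1 1 ^+ d in Lw *.
have c00 : 0 <= c0 by rewrite exprn_ge0 ?normal_pdf_ge0.
pose o : Rvec R d := [tuple of nseq d 0].
have L2 : 2 <= L - 1 by lra.
have tauN (tau : {set J}) : w * #|tau|%:R <= 2^-1.
  by apply: le_trans Nw; rewrite mulrC ler_wpM2r// ler_nat max_card.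
have tau0 (tau : {set J}) : 0 <= w * #|tau|%:R by rewrite mulr_ge0.
have w4 : w <= 4^-1.
  apply: le_trans nw; rewrite ler_peMl// -[1]/(1%:R) ler_nat//.
have gsep j k x : j != k -> cube (b j) x -> gauss_vec (b k) x <= expR (- (L - 1)).
  move=> jk Bx; have [i Li] := sepb j k jk.
  by apply: (@gauss_vec_le_tail _ _ _ i L2); exact: dist_cube_separated Bx Li.
have gsep0 j x : cube (b j) x -> gauss_vec o x <= expR (- (L - 1)).
  move=> Bx; have [i Li] := sep0 j.
  apply: (@gauss_vec_le_tail _ _ _ i L2); apply: dist_cube_separated Bx _.
  by rewrite tnth_nseq subr0.
pose h := Num.sqrt (w * c0 / 4).
have h2 : h ^+ 2 = w * c0 / 4 by rewrite sqr_sqrtr// divr_ge0// mulr_ge0.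
have h0 : 0 <= h by exact: sqrtr_ge0.
have -> : w * c0 / 32 = h ^+ 2 / 8 by rewrite h2; field.
have f0 tau x : 0 <= spike_mixture b w tau x.
  apply: addr_ge0; rewrite mulr_ge0 ?gauss_vec_ge0//.
    by have := tauN tau; lra.
  by apply: sumr_ge0 => j _; exact: gauss_vec_ge0.
have mf tau : measurable_fun setT (spike_mixture b w tau).
  exact: measurable_spike_mixture.
have f1 tau : (\int[lebesgue_vec]_x (spike_mixture b w tau x)%:E = 1)%E.
  by apply: integral_spike_mixture => //; have := tauN tau; lra.
apply: (@assouad_hellinger R d n J (spike_mixture b w) (cube \o b) _
  (1 - 2 * w) h) => //.
- move=> tau; apply: (spike_mixture_in_class (M := M)) => //; lra.
- by move=> j; exact: measurable_cube.
- by move=> j; exact: lebesgue_cube.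
- apply/trivIsetP => j k _ _ jk; apply/seteqP; split => // x [/= Bj Bk].
  have [i Li] := sepb j k jk.
  have := dist_cube_separated Bj Li; move: (Bk i); rewrite /= in_itv/=.
  by move=> /andP[? ?]; rewrite ger0_norm; lra.
- lra.
- apply: le_trans (bernoulli_ineq n _); first by lra.
  by apply/andP; split; lra.
(* f_(j + tau) - (1 - 2 w) f_tau is at least
   2 w f_tau - w phi >= (2 w (1 - w #|tau|) - w) phi >= 0. *)
- move=> tau j x jt; rewrite /spike_mixture cardsU1 jt finset.big_setU1//=.
  have := tauN tau; have := tau0 tau.
  have := gauss_vec_ge0 o x; have := gauss_vec_ge0 (b j) x.
  have S0 : 0 <= \sum_(k in tau) gauss_vec (b k) x.
    by apply: sumr_ge0 => k _; exact: gauss_vec_ge0.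
  move: S0; rewrite -/o natrD; set S := \sum_(_ in _) _; set t := #|tau|%:R.
  move=> S0 gj go t0 tw.
  have : 0 <= w * S by rewrite mulr_ge0.
  have : 0 <= w * gauss_vec (b j) x by rewrite mulr_ge0.
  have : 0 <= w * w * S by rewrite !mulr_ge0.
  have : w * (w * t) * gauss_vec o x <= w * 2^-1 * gauss_vec o x.
    by rewrite ler_wpM2r// ler_wpM2l.
  lra.
- move=> tau j x jt Bx; rewrite /h ler_sqrt ?divr_ge0 ?mulr_ge0//.
  apply: (@le_trans _ _ (expR (- (L - 1)))); last by lra.
  have S1 : \sum_(k in tau) gauss_vec (b k) x <= expR (- (L - 1)) * #|tau|%:R.
    rewrite mulr_natr -sumr_const; apply: ler_sum => k kt.
    by apply: gsep Bx; apply: contraNneq jt => ->.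
  have := ler_wpM2l w0 S1; have := gsep0 j x Bx; have := tauN tau.
  rewrite /spike_mixture -/o => ? g0 ?.
  have : (1 - w * #|tau|%:R) * gauss_vec o x <=
    (1 - w * #|tau|%:R) * expR (- (L - 1)) by rewrite ler_wpM2l//; lra.
  lra.
- move=> tau j x jt Bx.
  rewrite -[leLHS]ger0_norm ?mulr_ge0// -sqrtr_sqr ler_sqrt// exprMn h2.
  apply: (@le_trans _ _ (w * gauss_vec (b j) x)).
    have := ler_wpM2l w0 (gauss_vec_ge_cube Bx); rewrite -/c0; lra.
  rewrite /spike_mixture (big_setD1 j)//= mulrDr.
  have : 0 <= w * \sum_(k in tau :\ j) gauss_vec (b k) x.
    by rewrite mulr_ge0// sumr_ge0// => k _; exact: gauss_vec_ge0.
  have : 0 <= (1 - w * #|tau|%:R) * gauss_vec o x.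
    by rewrite mulr_ge0 ?gauss_vec_ge0//; have := tauN tau; lra.
  by rewrite -/o; lra.
Qed.
End gaussian.

(** * The grid and the choice of the parameters *)

(** The coordinates start at L rather than 0, so that every site is also
    L-separated from the origin. *)
Definition grid_point (R : realType) (d m : nat) (L : R)
    (k : {ffun 'I_d -> 'I_m}) : Rvec R d :=
  [tuple L * (k i).+1%:R | i < d].

Lemma grid_lower_bound (R : realType) (d n m : nat) (p K w L : R) :
  (0 < d)%N -> (0 < n)%N -> 0 < p -> 0 <= K -> 0 <= w -> 3 <= L ->
  m%:R ^+ d * w <= 2^-1 -> n%:R * w <= 4^-1 ->
  4 * expR (- (L - 1)) <= w * normal_pdf 0 1 1 ^+ d ->
  m%:R ^+ d * w * (d%:R * (L * m%:R)) `^ p <= K `^ p ->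
  ((m%:R ^+ d * (w * normal_pdf 0 1 1 ^+ d / 32))%:E <=
   minimax_risk n (mixture_class (bounded_moment d p K)))%E.
Proof.
move=> d0 n0 p0 K0 w0 L3 Nw nw Lw NwM.
have L0 : 0 <= L by lra.
have cardJ : #|{: {ffun 'I_d -> 'I_m}}|%:R = m%:R ^+ d :> R.
  by rewrite card_ffun !card_ord natrX.
rewrite -cardJ in Nw NwM *.
apply: (packing_lower_bound (b := grid_point L) (L := L)
  (M := (d%:R * (L * m%:R)) `^ p)) => //.
- exact: powR_ge0.
- move=> j k /eqP jk.
  have [i jki] : exists i, j i != k i.
    apply/existsP; apply: contra_notT jk; rewrite negb_exists => /forallP jk.
    by apply/ffunP => i; apply/eqP; move: (jk i); rewrite negbK.
  exists i; rewrite /grid_point !tnth_mktuple -mulrBr normrM ger0_norm//.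
  rewrite ler_peMr//; move: jki; rewrite -val_eqE/= neq_ltn.
  have lt1 (s t : nat) : (s < t)%N -> 1 <= `|s.+1%:R - t.+1%:R : R|.
    move=> st; rewrite distrC -natrB; last by rewrite ltnS ltnW.
    by rewrite normr_nat -[1]/(1%:R) ler_nat subn_gt0 ltnS.
  by case/orP => ?; [|rewrite distrC]; exact: lt1.
- move=> j; exists (Ordinal d0); rewrite /grid_point tnth_mktuple.
  rewrite normrM ger0_norm// normr_nat ler_peMr//.
  by rewrite -[1]/(1%:R) ler_nat.
- move=> k; rewrite ge0_ler_powR ?(ltW p0)// ?nnegrE ?sqrtr_ge0// ?mulr_ge0//.
  rewrite -[leRHS]ger0_norm ?mulr_ge0// -sqrtr_sqr ler_sqrt ?sqr_ge0//.
  apply: (@le_trans _ _ (\sum_(i < d) (L * m%:R) ^+ 2)).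
    apply: ler_sum => i _; rewrite /grid_point tnth_mktuple.
    rewrite ler_sqr ?nnegrE ?mulr_ge0// ler_wpM2l// ler_nat.
    exact: ltn_ord.
  rewrite sumr_const card_ord -[leLHS]mulr_natl [leRHS]exprMn ler_wpM2r ?sqr_ge0//.
  by rewrite -natrX ler_nat -mulnn leq_pmulr.
Qed.

Theorem theorem2p3 (R : realType) (d : nat) (p : R)
    (hd : (1 <= d)%N) (hp : 0 < p) :
  exists2 c : R, 0 < c &
    forall n : nat, (2 <= n)%N -> forall K : R, c^-1 <= K ->
      ((c * n%:R `^ (- (p / (p + d%:R))) * ln n%:R `^ (- (3 * d%:R / 2)))%:E
       <= minimax_risk n (mixture_class (bounded_moment d p K)))%E.
Proof.
(* c0 is the minimum of the Gaussian kernel on the unit cube, and c1 = n w is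
   fixed by 2^d c1 = 1/4, since there are at most 2^d n sites. *)
pose c0 : R := normal_pdf 0 1 1 ^+ d.
have c0_gt0 : 0 < c0.
  by rewrite exprn_gt0// normal_pdf01E mulr_gt0 ?expR_gt0 ?normal_peak_gt0 ?oner_neq0.
have c0_le1 : c0 <= 1 by rewrite exprn_ile1 ?normal_pdf_ge0 ?normal_pdf01_le1.
pose c1 : R := (4 * 2 ^+ d)^-1.
have pow2 : 1 <= 2 ^+ d :> R by rewrite exprn_ege1// ler1n.
have c1_gt0 : 0 < c1 by rewrite invr_gt0; lra.
have c1_le : c1 <= 4^-1 by rewrite /c1 lef_pV2 ?posrE; lra.
have c10_gt0 : 0 < c1 * c0 by rewrite mulr_gt0.
(* L = C3 log n must be at least log n + 3 + C2, where exp(- C2) = c1 c0 / 4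
   makes the tail exp(-(L - 1)) at most w c0 / 4; as log n is bounded below
   only by log 2, C3 absorbs the additive constants. *)
pose C2 : R := ln (4 / (c1 * c0)).
have C2_ge0 : 0 <= C2.
  by rewrite ln_ge0// ler_pdivlMr// mul1r; nra.
have ln2_gt0 : 0 < ln 2 :> R by rewrite ln_gt0// ltr1n.
pose C3 : R := 1 + (3 + C2) / ln 2.
have C3_ge1 : 1 <= C3 by rewrite lerDl divr_ge0 ?(ltW ln2_gt0)//; lra.
have dR : 1 <= d%:R :> R by rewrite ler1n.
pose q : R := p + d%:R.
have q_gt0 : 0 < q by rewrite /q; lra.
(* log n <= q n^(1/q) bounds L, hence the extent L m of the grid, by
   C5 n^(1/q). *)
pose C5 : R := 1 + C3 * q.
have C5_gt0 : 0 < C5 by rewrite /C5; nra.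
pose cA : R := c1 * c0 / 32 / C3 ^+ d * ln 2 `^ (d%:R / 2).
have cA_gt0 : 0 < cA.
  by rewrite /cA mulr_gt0 ?powR_gt0// divr_gt0 ?exprn_gt0// ?divr_gt0//; lra.
exists (Num.min cA (d%:R * C5)^-1).
  by rewrite lt_min cA_gt0 invr_gt0 mulr_gt0//; lra.
move=> n n2 K cK.
have dC5K : d%:R * C5 <= K.
  apply: le_trans cK; rewrite -[leLHS]invrK lef_pV2 ?posrE; last 2 first.
  - by rewrite invr_gt0 mulr_gt0//; lra.
  - by rewrite lt_min cA_gt0 invr_gt0 mulr_gt0//; lra.
  by rewrite ge_min lexx orbT.
have dC5_ge0 : 0 <= d%:R * C5 by rewrite mulr_ge0// ltW.
pose N : R := n%:R; pose l := ln N.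
have N2 : 2 <= N by rewrite ler_nat.
have N_gt0 : 0 < N by lra.
have l_ge : ln 2 <= l by rewrite ler_ln ?posrE.
have l_gt0 : 0 < l by lra.
pose y := N `^ q^-1.
have y_gt0 : 0 < y by exact: powR_gt0.
have yq : y `^ q = N by rewrite -powRrM mulVf ?gt_eqF// powRr1// ltW.
have y_ge1 : 1 <= y.
  by rewrite -(powRr0 N) ler_powR ?invr_ge0 ?(ltW q_gt0)//; lra.
have lqy : l <= q * y.
  have := ln_sublinear y_gt0; rewrite ln_powR mulrC ltr_pdivrMr// => /ltW.
  by rewrite mulrC.
pose L := C3 * l.
have L_ge : l + 3 + C2 <= L.
  rewrite /L /C3 mulrDl mul1r -addrA lerD2l.
  rewrite mulrAC -mulrA ler_peMr//; first by lra.
  by rewrite ler_pdivlMr// mul1r.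
have L_ge3 : 3 <= L by lra.
have L_gt0 : 0 < L by lra.
(* The successor keeps m positive when n is small. *)
pose m := (Num.truncn (y / L)).+1.
have yL_ge0 : 0 <= y / L by rewrite divr_ge0 ?ltW.
have m_ge : y / L <= m%:R by exact/ltW/truncnS_gt.
have m_le : m%:R <= y / L + 1 by rewrite -natr1 lerD2r truncn_le.
have m2y : m%:R <= 2 * y.
  have : y / L <= y by rewrite ler_pdivrMr// ler_peMr ?(ltW y_gt0)//; lra.
  lra.
have Lm : L * m%:R <= C5 * y.
  apply: (@le_trans _ _ (L * (y / L + 1))); first by rewrite ler_wpM2l// ltW.
  rewrite mulrDr mulr1 mulrC divfK ?gt_eqF// /C5 mulrDl mul1r lerD2l.
  by rewrite /L -mulrA ler_wpM2l//; lra.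
have yd : y ^+ d <= N.
  rewrite -powR_mulrn ?(ltW y_gt0)// -[leRHS]yq ler_powR// /q; lra.
have md : m%:R ^+ d <= 2 ^+ d * y ^+ d.
  by rewrite -exprMn lerXn2r ?nnegrE// mulr_ge0// ltW.
pose w := c1 / N.
have w_gt0 : 0 < w by rewrite divr_gt0.
have w_ge0 := ltW w_gt0.
have c12 : 2 ^+ d * c1 = 4^-1 by rewrite /c1 invfM mulrCA divff ?mulr1//; lra.
have Nw : N * w = c1 by rewrite /w mulrC divfK ?gt_eqF.
have mdw : m%:R ^+ d * w <= 4^-1 * (y ^+ d / N).
  apply: (@le_trans _ _ (2 ^+ d * y ^+ d * w)); first by rewrite ler_wpM2r.
  by rewrite -c12 /w le_eqVlt; apply/orP; left; apply/eqP; ring.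
have ydN : y ^+ d / N <= 1 by rewrite ler_pdivrMr// mul1r.
have mdw_ge0 : 0 <= m%:R ^+ d * w by rewrite mulr_ge0 ?exprn_ge0.
apply: (@le_trans _ _ (m%:R ^+ d * (w * c0 / 32))%:E); last first.
  apply: (@grid_lower_bound R d n m p K w L) => //.
  - exact: ltnW.
  - lra.
  - lra.
  - by rewrite -/N Nw.
  - have : expR (- (L - 1)) <= expR (- (l + C2)) by rewrite ler_expR; lra.
    have -> : expR (- (l + C2)) = (N * (4 / (c1 * c0)))^-1.
      by rewrite expRN expRD /l /C2 !lnK ?posrE ?divr_gt0.
    move=> /(ler_wpM2l (ler0n _ 4)) /le_trans; apply.
    rewrite -/c0 /w le_eqVlt; apply/orP; left; apply/eqP.
    by field; rewrite !gt_eqF.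
  - apply: (@le_trans _ _ ((d%:R * C5) `^ p)); last first.
      by rewrite ge0_ler_powR ?(ltW hp)// ?nnegrE//; lra.
    apply: (@le_trans _ _ (4^-1 * (y ^+ d / N) * (d%:R * (C5 * y)) `^ p)).
      rewrite ler_pM ?powR_ge0// ge0_ler_powR ?(ltW hp)// ?nnegrE.
      + by rewrite mulr_ge0// mulr_ge0// ltW.
      + by rewrite mulr_ge0// mulr_ge0// ltW.
      + by rewrite ler_wpM2l.
    rewrite mulrA (powRM p dC5_ge0 (ltW y_gt0)) -powR_mulrn ?(ltW y_gt0)//.
    have -> : 4^-1 * (y `^ d%:R / N) * ((d%:R * C5) `^ p * y `^ p) =
        4^-1 * (d%:R * C5) `^ p * (y `^ p * y `^ d%:R / N) by ring.
    rewrite -powRD; last by rewrite gt_eqF.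
    rewrite yq divff ?gt_eqF// mulr1 ler_piMl ?powR_ge0//; lra.
have rate : N `^ (- (p / q)) = y ^+ d / N.
  rewrite mulrC -mulrN powRrM powRN -/y -yq /q powRD ?(gt_eqF y_gt0) ?implybT//.
  rewrite powR_mulrn ?(ltW y_gt0)//; field.
  by rewrite expf_neq0 ?gt_eqF ?powR_gt0.
rewrite lee_fin rate.
(* The grid loses only (log n)^(-d); the rest of the exponent 3d/2 is traded
   for a constant, log n being at least log 2. *)
have lnrate : l `^ (- (3 * d%:R / 2)) <= (l ^+ d)^-1 * (ln 2 `^ (d%:R / 2))^-1.
  have -> : - (3 * d%:R / 2) = - d%:R + - (d%:R / 2) :> R by field.
  rewrite powRD; last by rewrite (gt_eqF l_gt0) implybT.
  rewrite !powRN powR_mulrn ?(ltW l_gt0)// ler_wpM2l ?invr_ge0 ?exprn_ge0 ?(ltW l_gt0)//.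
  rewrite lef_pV2 ?posrE ?powR_gt0// ge0_ler_powR ?nnegrE ?(ltW l_gt0) ?(ltW ln2_gt0)//.
have ydN0 : 0 <= y ^+ d / N by rewrite divr_ge0 ?exprn_ge0 ?ltW.
apply: (@le_trans _ _ (cA * (y ^+ d / N) *
  ((l ^+ d)^-1 * (ln 2 `^ (d%:R / 2))^-1))).
  apply: ler_pM => //; rewrite ?powR_ge0//.
    by rewrite mulr_ge0// le_min (ltW cA_gt0) invr_ge0.
  by rewrite ler_wpM2r// ge_min lexx.
apply: (@le_trans _ _ ((y / L) ^+ d * (w * c0 / 32))); last first.
  rewrite ler_wpM2r//; last by rewrite lerXn2r ?nnegrE.
  by rewrite divr_ge0// (mulr_ge0 w_ge0)// ltW.
rewrite le_eqVlt; apply/orP; left; apply/eqP.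
rewrite /cA /w /L expr_div_n exprMn; field.
by rewrite !expf_neq0 ?gt_eqF ?powR_gt0//; lra.
Qed.
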